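(* Let $\mathcal{H}$ be a hypergraph. (a) If $\mathcal{H}$ is acyclic, then $K_{\mathcal{H}}$ is acyclic as well, and $K_{\mathcal{H}}$ has the homotopy type of finitely many discrete points. (b) If $K_{\mathcal{H}}$ is the associated simplicial complex of a finite disjoint union of simplices whose sets of vertices are mutually non-intersecting (that is, of a hypergraph $\{\sigma_1,\ldots,\sigma_m\}$ with the $\sigma_j$ pairwise disjoint non-empty finite sets), then $\mathcal{H}$ is acyclic.
   Context: A hypergraph $\mathcal{H}$ is a set of non-empty subsets (called hyperedges) of a finite vertex set $V_{\mathcal{H}}$, where $V_{\mathcal{H}}$ is the union of the hyperedges. A simplicial complex is a hypergraph closed under taking non-empty subsets of hyperedges. The associated simplicial complex $K_{\mathcal{H}}$ of $\mathcal{H}$ consists of all non-empty subsets of hyperedges of $\mathcal{H}$; its homotopy type means that of its geometric realization. A hypergraph (in particular, a simplicial complex regarded as a hypergraph) is called acyclic if it can be reduced to the empty set by repeatedly applying the following two operations: (O1) if $v$ is a vertex that belongs to only one hyperedge, then delete $v$ from the hyperedge containing it (a hyperedge that becomes empty disappears); (O2) if $\sigma\subsetneq\sigma'$ are two hyperedges, then delete $\sigma$ from the hypergraph. *)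

(* Defs.v *)
From Stdlib Require Import Relation_Operators.
From HB Require Import structures.
From mathcomp Require Import all_boot all_order all_algebra.

Set Implicit Arguments.
Unset Strict Implicit.
Unset Printing Implicit Defensive.

(* This section precedes the import of mathcomp-classical, which shadows set0,
   trivIset and the set-builder notations of finset. *)
Section Hypergraphs.
Variable T : finType.
Implicit Types (H K S : {set {set T}}) (s t : {set T}) (v : T).

(* The hyperedges live in an ambient finite type T; the vertex set of H is
   cover H, which may be smaller than T. *)
Definition hypergraph H := set0 \notin H.

Definition associated_complex H : {set {set T}} :=
  [set s | (s != set0) && [exists t in H, s \subset t]].

(* As H is a set, s :\ v is merged with an equal hyperedge if there is one. *)
Inductive reduction H : {set {set T}} -> Prop :=
| delete_vertex v s of [set t in H | v \in t] = [set s] :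
    reduction H (((s :\ v) |: (H :\ s)) :\ set0)
| delete_edge s s' of s \in H & s' \in H & s \proper s' :
    reduction H (H :\ s).

Definition acyclic H := clos_refl_trans _ reduction H set0.

Definition disjoint_simplices S := hypergraph S /\ trivIset S.

Definition support_in K (R : nmodType) (x : T -> R) :=
  [set v | x v != 0%R] \in K.

End Hypergraphs.

From mathcomp Require Import all_classical all_reals all_analysis.

Import Order.TTheory GRing.Theory Num.Theory.
Import numFieldNormedType.Exports.

Local Open Scope classical_set_scope.
Local Open Scope ring_scope.

(* Points are given by their barycentric coordinates; set_type carries the
   subspace topology. *)
Definition realization_set (R : realType) (T : finType) (K : {set {set T}}) :
    set {ptws T -> R} :=
  [set x | [/\ forall v, 0 <= x v, \sum_v x v = 1 & support_in K x]].

Definition realization (R : realType) (T : finType) (K : {set {set T}}) :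
    topologicalType :=
  set_type (@realization_set R T K).

Arguments realization R {T} K.

Section Homotopy.
Variable R : realType.

Definition homotopic (X Y : topologicalType) (f g : X -> Y) :=
  exists h : X * R -> Y,
    [/\ {within [set: X] `*` `[0, 1], continuous h},
        forall x, h (x, 0) = f x & forall x, h (x, 1) = g x].

Definition homotopy_equivalent (X Y : topologicalType) :=
  exists (f : X -> Y) (g : Y -> X),
    [/\ continuous f, continuous g,
        homotopic (g \o f) id & homotopic (f \o g) id].

End Homotopy.

(* Main.v *)
(* Reducing by (O2) alone leads from K_H to H, which gives the first half of
   (a), and from H to its maximal hyperedges, which in (b) are the disjoint
   simplices S; those are emptied one vertex at a time by (O1).

   For the homotopy type, (O2) does not change K_H, while (O1), applied to a
   vertex v of the single hyperedge s, removes from K_H all simplices containing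
   v. If s = {v}, this removes an isolated point. Otherwise choose w in s
   different from v: every simplex containing v stays a simplex after adding w,
   so sliding the weight of v onto w along straight lines is a deformation
   retraction of K_H onto the complex without v. By induction K_H deforms onto
   finitely many of its vertices through a locally constant retraction. *)
Require Import Defs.
From mathcomp Require Import all_boot all_order all_algebra.
From Stdlib Require Import Relation_Operators Operators_Properties.

Set Implicit Arguments.
Unset Strict Implicit.
Unset Printing Implicit Defensive.

(** * Reductions of hypergraphs and of their associated complexes *)

Section Hypergraphs.
Variable T : finType.
Implicit Types (H K S : {set {set T}}) (s t : {set T}) (v w : T).

Lemma associated_complexP H s :
  reflect (s != set0 /\ exists2 t, t \in H & s \subset t)
          (s \in associated_complex H).
Proof.
rewrite inE; apply: (iffP andP) => -[s0].
  by move/existsP=> [t /andP[tH st]]; split=> //; exists t.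
by move=> [t tH st]; split=> //; apply/existsP; exists t; rewrite tH.
Qed.

Lemma mem_associated_complex H s :
  hypergraph H -> s \in H -> s \in associated_complex H.
Proof.
move=> hH sH; apply/associated_complexP; split; last by exists s.
by apply: contra hH => /eqP <-.
Qed.

Lemma associated_complexS H s t :
  t \in associated_complex H -> s \subset t -> s != set0 ->
  s \in associated_complex H.
Proof.
move=> /associated_complexP[_ [e eH te]] st s0; apply/associated_complexP.
by split=> //; exists e => //; apply: subset_trans te.
Qed.

(** Only edges outside [H] are deleted, so the edges of [H] properly containing them stay available
    for (O2) to the end. *)
Lemma delete_edges S H : H \subset S ->
  (forall s, s \in S -> s \notin H -> exists2 t, t \in H & s \proper t) ->
  clos_refl_trans _ (@reduction T) S H.
Proof.
move: {2}#|_| (erefl #|S :\: H|) => n; elim: n S => [|n IHn] S nE HS mS.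
  suff -> : S = H by apply: rt_refl.
  apply/eqP; rewrite eqEsubset HS andbT -setD_eq0 -cards_eq0.
  exact/eqP.
have /card_gt0P[s] : 0 < #|S :\: H| by rewrite nE.
rewrite inE => /andP[sH sS]; have [t tH st] := mS s sS sH.
apply: (rt_trans _ _ _ (S :\ s)).
  by apply: rt_step; apply: (delete_edge sS (subsetP HS t tH) st).
apply: IHn.
- have := cardsD1 s (S :\: H); rewrite nE inE sH sS /= add1n => -[->].
  by apply: eq_card => u; rewrite !inE andbCA.
- by rewrite subsetD1 HS.
- by move=> u /setD1P[_ uS]; apply: mS.
Qed.

Lemma associated_complex_reduces H : hypergraph H ->
  clos_refl_trans _ (@reduction T) (associated_complex H) H.
Proof.
move=> hH; apply: delete_edges.
  by apply/subsetP => s; apply: mem_associated_complex.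
move=> s /associated_complexP[_ [t tH st]] sH; exists t => //.
by rewrite properEneq st andbT; apply: contraNneq sH => ->.
Qed.

Lemma associated_complex_delete_edge H s t :
  s \in H -> t \in H -> s \proper t ->
  associated_complex (H :\ s) = associated_complex H.
Proof.
move=> sH tH st; apply/setP => u; apply/associated_complexP/associated_complexP.
  by move=> [u0 [e /setD1P[_ eH] ue]]; split=> //; exists e.
move=> [u0 [e eH ue]]; split=> //; have [es|es] := eqVneq e s; last first.
  by exists e => //; rewrite !inE es.
exists t; last by rewrite (subset_trans ue) // es proper_sub.
by rewrite !inE tH andbT; apply: contraTneq st => ->; rewrite properxx.
Qed.

Section DeleteVertex.
Variables (H : {set {set T}}) (v : T) (s : {set T}).
Hypothesis vs : [set t in H | v \in t] = [set s].

Lemma unique_edge : s \in H /\ v \in s.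
Proof. by have := set11 s; rewrite -vs inE => /andP. Qed.

Lemma unique_edgeP t : t \in H -> v \in t -> t = s.
Proof. by move=> tH vt; apply/set1P; rewrite -vs inE tH. Qed.

Lemma associated_complex_unique_edge t :
  t \in associated_complex H -> v \in t -> t \subset s.
Proof.
move=> /associated_complexP[_ [e eH te]] vt.
by rewrite -(unique_edgeP eH (subsetP te v vt)).
Qed.

(** The faces of [s :\ v] are the faces of [s] avoiding [v], and no other edge contains [v]. Merging
    equal edges or dropping [set0] does not affect non-empty faces. *)
Lemma associated_complex_delete_vertex :
  associated_complex (((s :\ v) |: (H :\ s)) :\ set0) =
  [set t in associated_complex H | v \notin t].
Proof.
have [sH _] := unique_edge.
apply/setP => t; rewrite [RHS]inE; apply/idP/andP; last first.
  move=> [/associated_complexP[t0 [e eH te]] vt].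
  apply/associated_complexP; split=> //; have [es|es] := eqVneq e s.
    have tsv : t \subset s :\ v by rewrite subsetD1 vt andbT -es.
    exists (s :\ v) => //; rewrite !inE eqxx andbT.
    by apply: contraNneq t0 => sv0; rewrite -subset0 -sv0.
  exists e => //; rewrite !inE es eH orbT andbT.
  by apply: contraNneq t0 => e0; rewrite -subset0 -e0.
move=> /associated_complexP[t0 [e /setD1P[_ /setU1P[->|/setD1P[es eH]]] te]].
  move: te; rewrite subsetD1 => /andP[ts vt]; split=> //.
  by apply/associated_complexP; split=> //; exists s.
split; first by apply/associated_complexP; split=> //; exists e.
by apply: contra es => vt; apply/eqP/(unique_edgeP eH)/(subsetP te).
Qed.

End DeleteVertex.

Lemma hypergraph_reduction H H' :
  hypergraph H -> reduction H H' -> hypergraph H'.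
Proof.
move=> hH [v s _|s s' _ _ _]; rewrite /hypergraph ?inE ?eqxx //.
by rewrite (negPf hH) andbF.
Qed.

(** The first reduction of the sequence is peeled off each time; being a hypergraph persists along
    the sequence, so it is available at every step. *)
Lemma acyclic_ind (P : {set {set T}} -> Prop) : P set0 ->
  (forall H H', hypergraph H -> reduction H H' -> P H' -> P H) ->
  forall H, hypergraph H -> acyclic H -> P H.
Proof.
move=> P0 PS H hH /(clos_rt_rt1n _ _ _ _); move eZ: set0 => Z r.
elim: r eZ hH => [K <- // |H1 H2 H3 r _ IH eZ hH1].
exact: PS hH1 r (IH eZ (hypergraph_reduction hH1 r)).
Qed.

(** Disjointness puts each vertex in a single edge, so (O1) applies; it keeps the edges disjoint and
    shrinks [cover S], whose size drives the induction. *)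
Lemma disjoint_simplices_acyclic S : disjoint_simplices S -> acyclic S.
Proof.
move: {2}#|cover S|.+1 (ltnSn #|cover S|) => n.
elim: n S => // n IHn S leSn [hS /trivIsetP tS].
have [->|[s sS]] := set_0Vmem S; first exact: rt_refl.
have [s0|[v vs]] := set_0Vmem s; first by move: hS; rewrite /hypergraph -s0 sS.
have uvs : [set t in S | v \in t] = [set s].
  apply/setP => t; rewrite !inE; apply/andP/eqP => [[tS' vt]|->//].
  apply/eqP/negPn/negP => ts; have /pred0P/(_ v) := tS t s tS' sS ts.
  by rewrite /= vt vs.
apply: rt_trans (rt_step _ _ _ _ (delete_vertex uvs)) _.
set S' := _ :\ set0.
(* Each edge [t] of [S'] is traced to an edge [u] of [S] around it. As [u] determines [t], distinct
   edges of [S'] lie in distinct, hence disjoint, edges of [S]. *)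
have sub t : t \in S' -> exists2 u, u \in S &
    [/\ t \subset u, v \notin t & t = s :\ v /\ u = s \/ t = u /\ u != s].
  rewrite !inE => /andP[_ /orP[/eqP->|/andP[ts tS']]].
    by exists s => //; split; [rewrite subsetDl|rewrite !inE eqxx|left].
  exists t => //; split=> //; last by right.
  by apply: contra ts => vt; apply/eqP/(unique_edgeP uvs tS' vt).
apply: IHn; last first.
  split; first by rewrite /hypergraph !inE eqxx.
  apply/trivIsetP => t1 t2 /sub[u1 u1S [tu1 _ c1]] /sub[u2 u2S [tu2 _ c2]] t12.
  apply: (disjointWl tu1); apply: (disjointWr tu2); apply: tS => //.
  apply: contraNneq t12 => u12.
  case: c1 => -[-> u1s]; case: c2 => -[-> u2s] //; last by rewrite u12.
    by rewrite -u12 u1s eqxx in u2s.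
  by rewrite u12 u2s eqxx in u1s.
rewrite -ltnS; apply: leq_trans leSn; rewrite ltnS; apply: proper_card.
apply/properP; split.
  apply/bigcupsP => t /sub[u uS [tu _ _]].
  exact: subset_trans tu (bigcup_sup _ uS).
exists v; first by apply/bigcupP; exists s.
by apply/bigcupP => -[t /sub[u _ [_ /negP]]].
Qed.

(** An edge [s] of [S] lies in some [t] in [H], and [t] in some [s'] in [S]; disjointness forces
    [s = s'], hence [s = t]. So [S] is part of [H], and (O2) deletes the rest of [H]. *)
Lemma acyclic_of_disjoint_simplices_complex H S :
  hypergraph H -> disjoint_simplices S ->
  associated_complex H = associated_complex S -> acyclic H.
Proof.
move=> hH dS KHS; have [hS /trivIsetP tS] := dS.
apply: rt_trans (disjoint_simplices_acyclic dS); apply: delete_edges.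
  apply/subsetP => s sS; have := mem_associated_complex hS sS.
  rewrite -KHS => /associated_complexP[s0 [t tH st]].
  have := mem_associated_complex hH tH.
  rewrite KHS => /associated_complexP[_ [s' s'S ts']].
  suff ss' : s = s'.
    by rewrite (_ : s = t) //; apply/eqP; rewrite eqEsubset st ss'.
  apply/eqP; apply: contraNT s0 => /(tS _ _ sS s'S).
  rewrite -setI_eq0 => /eqP ss'0; rewrite -subset0 -ss'0 subsetI subxx.
  exact: subset_trans ts'.
move=> s sH sS; have := mem_associated_complex hH sH.
rewrite KHS => /associated_complexP[_ [t tS' st]]; exists t => //.
by rewrite properEneq st andbT; apply: contraNneq sS => ->.
Qed.

Lemma support_inP K (R : nmodType) (x : T -> R) :
  reflect (exists2 t, t \in K & forall u, (u \in t) = (x u != 0%R))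
          (support_in K x).
Proof.
apply: (iffP idP) => [xK|[t tK xt]].
  by exists [set u | x u != 0%R] => // u; rewrite inE.
rewrite /support_in (_ : [set _ | _] = t) //.
by apply/setP => u; rewrite inE xt.
Qed.

End Hypergraphs.

From mathcomp Require Import all_classical all_reals all_analysis.
From mathcomp Require Import ring lra.

Import Order.TTheory GRing.Theory Num.Theory.
Import numFieldNormedType.Exports.
Local Open Scope classical_set_scope.
Local Open Scope ring_scope.

(** * Deformations onto vertices, in coordinates *)

Section VertexDeformation.
Variables (R : realType) (T : finType).
Implicit Types (A B : set (T -> R)) (v w : T).

Definition vertex v : T -> R := fun u => (u == v)%:R.

Lemma vertexE v u : vertex v u = (u == v)%:R. Proof. by []. Qed.

Lemma vertex_inj : injective vertex.
Proof.
move=> v w /(congr1 (fun x => x v)); rewrite !vertexE eqxx.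
by case: eqVneq => // _ /eqP; rewrite oner_eq0.
Qed.

(* Within A, f is a locally constant retraction onto finitely many vertices and
   h is a homotopy from f to the identity. Continuity is tested along arbitrary
   filters, coordinate by coordinate, so that no topology on T -> R is involved.
   The codomain of f is not T, which may be empty. *)
Definition deforms_to_vertices A :=
  exists (f : (T -> R) -> T -> R) (h : (T -> R) -> R -> T -> R),
    [/\ forall x, A x -> [/\ A (f x), f (f x) = f x & exists v, f x = vertex v],
        forall x (t : R), A x -> A (h x t),
        forall x (t : R), A x -> t <= 0 -> h x t = f x,
        forall x (t : R), A x -> 1 <= t -> h x t = x
      & forall (I : Type) (F : set_system I) (a : I -> T -> R) (b : I -> R) x
            (t : R),
          Filter F -> A x -> (\forall i \near F, A (a i)) ->
          (forall u, (a i u) @[i --> F] --> x u) -> b i @[i --> F] --> t ->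
          (\forall i \near F, f (a i) = f x) /\
          forall u, (h (a i) (b i) u) @[i --> F] --> h x t u].

Lemma deforms_to_vertices0 : deforms_to_vertices set0.
Proof. by exists id, (fun x _ => x); split. Qed.

(** The coordinate at [v] is 1 at the new point and 0 on [A], so it separates the two, and both maps
    extend by fixing [vertex v]. *)
Lemma deforms_to_vertices_isolated A v : (forall x, A x -> x v = 0) ->
  deforms_to_vertices A -> deforms_to_vertices (vertex v |` A).
Proof.
move=> Av [f [h [hf hA h0 h1 hc]]].
have vv : vertex v v = 1 by rewrite vertexE eqxx.
exists (fun x => if x v == 0 then f x else vertex v).
exists (fun x t => if x v == 0 then h x t else x).
split=> /=.
- move=> x [->|Ax].
    by rewrite !vv !oner_eq0 vv oner_eq0; split; [left| |exists v].
  have [Afx ffx fxv] := hf x Ax.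
  by rewrite (Av x Ax) eqxx (Av _ Afx) eqxx; split => //; right.
- move=> x t [->|Ax]; first by rewrite vv oner_eq0; left.
  by rewrite (Av x Ax) eqxx; right; exact: hA.
- move=> x t [->|Ax] t0; first by rewrite vv oner_eq0.
  by rewrite (Av x Ax) eqxx h0.
- move=> x t [->|Ax] t1; first by rewrite vv oner_eq0.
  by rewrite (Av x Ax) eqxx h1.
move=> I F a b x t FF [->|Ax] aA ax bt.
  (* The coordinate at [v] tends to 1, so it is eventually positive, which excludes [A]. *)
  have av : \forall i \near F, a i = vertex v.
    have := @cvgr_gt R I F FF _ _ (ax v) 0; rewrite vv => /(_ ltr01) => gt0.
    near=> i; have [//|/Av av0] : (vertex v |` A) (a i) by near: i.
    suff : 0 < a i v by rewrite av0 ltxx.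
    by near: i.
  rewrite vv oner_eq0; split.
    by apply: filterS av => i ->; rewrite vv oner_eq0.
  move=> u; apply: cvg_near_cst.
  by apply: filterS av => i ->; rewrite vv oner_eq0.
(* Here the coordinate at [v] tends to 0, so it is eventually below 1, which excludes the isolated
   point. *)
have av : \forall i \near F, A (a i) /\ a i v = 0.
  have := @cvgr_lt R I F FF _ _ (ax v) 1; rewrite Av // => /(_ ltr01) => lt1.
  near=> i; have [aiv|Aai] : (vertex v |` A) (a i) by near: i.
    suff : a i v < 1 by rewrite aiv vv ltxx.
    by near: i.
  by rewrite Av.
have [fc hc'] := hc I F a b x t FF Ax (filterS (fun _ => @proj1 _ _) av) ax bt.
rewrite Av // eqxx; split.
  by apply: filterS2 av fc => i [_ ->] fai; rewrite eqxx.
move=> u; apply: cvg_trans (hc' u); apply: near_eq_cvg.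
by apply: filterS av => i [_ ->]; rewrite eqxx.
Unshelve. all: by end_near.
Qed.

(* Extends the identity of [0, 1] to R by the constants 0 and 1; written with
   absolute values for the sake of continuity. *)
Definition clamp (t : R) : R := (`|t| - `|t - 1| + 1) / 2.

Lemma clamp_le0 t : t <= 0 -> clamp t = 0.
Proof. by move=> t0; rewrite /clamp !ler0_norm; lra. Qed.

Lemma clamp_ge1 t : 1 <= t -> clamp t = 1.
Proof. by move=> t1; rewrite /clamp !ger0_norm; lra. Qed.

Lemma clamp01 t : 0 <= clamp t <= 1.
Proof.
have [t0|t0] := leP t 0; first by rewrite clamp_le0 // lexx ler01.
have [t1|t1] := leP 1 t; first by rewrite clamp_ge1 // lexx ler01.
by rewrite /clamp (gtr0_norm t0) ltr0_norm; lra.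
Qed.

Lemma cvg_clamp (I : Type) (F : set_system I) (b : I -> R) t : Filter F ->
  b i @[i --> F] --> t -> clamp (b i) @[i --> F] --> clamp t.
Proof.
move=> FF bt; apply: cvgMl; apply: cvgD; last exact: cvg_cst.
apply: cvgB; apply: cvg_norm => //; apply: cvgB => //; exact: cvg_cst.
Qed.

(** For [v] different from [w], all weight of [v] is moved onto [w]; the total weight is kept. *)
Definition slide v w (x : T -> R) : T -> R :=
  fun u => x u + x v * (vertex w u - vertex v u).

Lemma slide_id v w x : x v = 0 -> slide v w x = x.
Proof. by move=> xv; apply/funext => u; rewrite /slide xv mul0r addr0. Qed.

Lemma cvg_slide v w (I : Type) (F : set_system I) (a : I -> T -> R) x :
  Filter F -> (forall u, a i u @[i --> F] --> x u) ->
  forall u, slide v w (a i) u @[i --> F] --> slide v w x u.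
Proof. by move=> FF ax u; apply: cvgD => //; apply: cvgMl. Qed.

(* The homotopy of B runs on [0, 1/2], the straight line from slide v w to the
   identity on [1/2, 1]. *)
Lemma deforms_to_vertices_slide A B v w :
  B `<=` A -> (forall x, B x -> x v = 0) ->
  (forall x, A x -> B (slide v w x)) ->
  (forall x (c : R), A x -> 0 <= c <= 1 ->
    A (fun u => slide v w x u + c * (x u - slide v w x u))) ->
  deforms_to_vertices B -> deforms_to_vertices A.
Proof.
move=> BA Bv AB Aline [f [h [hf hB h0 h1 hc]]].
exists (f \o slide v w).
(* The two stages are added: the clamped factor is 0 during the first, and [h] rests at
   [slide v w x] during the second. Continuity thus needs no gluing at time 1/2. *)
exists (fun x t u => h (slide v w x) (2 * t) u
                     + clamp (2 * t - 1) * (x u - slide v w x u)).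
split=> /=.
- move=> x Ax; have [Bfx ffx fxv] := hf _ (AB x Ax).
  by split => //; [exact: BA|rewrite slide_id ?Bv].
- move=> x t Ax; have [t2|t2] := leP (2 * t) 1.
    rewrite clamp_le0 ?subr_le0 //.
    under eq_fun do rewrite mul0r addr0.
    by apply: BA; apply: hB; exact: AB.
  rewrite h1 ?(ltW t2) //; last exact: AB.
  by apply: Aline => //; exact: clamp01.
- move=> x t Ax t0; rewrite clamp_le0 ?h0; [|exact: AB|lra|lra].
  by apply/funext => u; rewrite mul0r addr0.
- move=> x t Ax t1; rewrite clamp_ge1 ?h1; [|exact: AB|lra|lra].
  by apply/funext => u; rewrite mul1r addrC subrK.
move=> I F a b x t FF Ax aA ax bt.
have b2 : (2 * b i) @[i --> F] --> 2 * t by apply: cvgMr.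
have sax := @cvg_slide v w I F a x FF ax.
have [] := hc I F (fun i => slide v w (a i)) (fun i => 2 * b i) _ _ FF
  (AB x Ax) _ sax b2.
  by apply: filterS aA => i; exact: AB.
move=> fc hc'; split=> // u; apply: cvgD => //; apply: cvgM.
  by apply: cvg_clamp; apply: cvgB => //; exact: cvg_cst.
by apply: cvgB.
Qed.

End VertexDeformation.

(** * From deformations to homotopy equivalences *)

Section HomotopyType.
Variables (R : realType) (T : finType).

(** Links the coordinatewise continuity in [deforms_to_vertices] to the topology of the
    realization. *)
Lemma cvg_coordinates (I : Type) (F : set_system I) (a : I -> T -> R)
    (x : T -> R) : Filter F ->
  (a i @[i --> F] --> (x : {ptws T -> R})) <->
  forall u, a i u @[i --> F] --> x u.
Proof.
move=> FF; exact: (@pointwise_cvgP (discrete_topology T) R (a @ F) x _).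
Qed.

Lemma deforms_to_vertices_homotopy (A : set {ptws T -> R}) :
  deforms_to_vertices A ->
  exists n, homotopy_equivalent R (set_type A) (discrete_topology 'I_n).
Proof.
move=> [f [h [hf hA h0 h1 hc]]].
(* By idempotence of [f], the vertices fixed by [f] are exactly its values on [A]; they become the
   discrete points. *)
pose D : {set T} :=
  [set v | `[< A (vertex R v) /\ f (vertex R v) = vertex R v >]]%SET.
have Aval (x : set_type A) : A (val x) by apply: set_mem; exact: valP.
have fD (x : set_type A) : {v | v \in D & f (val x) = vertex R v}.
  apply: cid2; have [Afx ffx [v fxv]] := hf _ (Aval x).
  by exists v => //; rewrite inE; apply/asboolP; rewrite -fxv ffx.
have inD (i : 'I_#|D|) :
    A (vertex R (enum_val i)) /\
    f (vertex R (enum_val i)) = vertex R (enum_val i).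
  by have := enum_valP i; rewrite inE => /asboolP.
have val_cvg (x : set_type A) u : val y u @[y --> x] --> val x u.
  apply: (cvg_coordinates (F := nbhs x) val (val x) _).1.
  exact: (@initial_continuous _ _ val x).
have hcont (p : set_type A * R) :
    (fun q => h (val q.1) q.2) @ p --> (h (val p.1) p.2 : {ptws T -> R}).
  have [] := hc _ (nbhs p) (fun q => val q.1) snd (val p.1) p.2 _ (Aval _).
  - by apply: nearW => q; exact: Aval.
  - by move=> u; apply: (cvg_comp _ _ (@cvg_fst _ _ _ _ _)) (val_cvg _ _).
  - exact: cvg_snd.
  by move=> _ /cvg_coordinates.
exists #|D|.
(* [D] may be empty, so the ranking needs a member of [D]; the vertex [f (val x)] itself provides
   one. *)
pose F (x : set_type A) : discrete_topology 'I_#|D| :=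
  enum_rank_in (s2valP (fD x)) (s2val (fD x)).
pose G (i : discrete_topology 'I_#|D|) : set_type A :=
  SigSub (mem_set (inD i).1).
have valF x : vertex R (enum_val (F x)) = f (val x).
  rewrite enum_rankK_in; [by rewrite -(s2valP' (fD x))|exact: (s2valP (fD x))].
exists F, G; split.
- move=> x; suff Fx : \forall y \near x, F y = F x.
    exact: (@cvg_near_cst _ _ _ _ _ (nbhs_filter x) Fx).
  have [] := hc _ (nbhs x) val (fun=> 0) (val x) 0 _ (Aval _) _ (val_cvg x) _.
  + by apply: nearW => y; exact: Aval.
  + exact: cvg_cst.
  move=> fx _; apply: filterS fx => y fyx.
  by apply/enum_val_inj/(@vertex_inj R); rewrite !valF.
- move=> i U /nbhs_singleton GiU; apply: (filterS _ (discrete_set1 i)) => j ->.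
  exact: GiU.
(* [h] stays in [A] at every real time, so the homotopy is continuous on the whole product with [R],
   not only over the unit interval. *)
- exists (fun p => SigSub (mem_set (hA _ p.2 (Aval p.1)))); split.
  + apply: continuous_subspaceT; apply: continuous_comp_initial => p.
    exact: hcont.
  + move=> x; apply/val_inj; apply: etrans (h0 _ _ (Aval x) (lexx 0)) _.
    exact/esym/valF.
  + by move=> x; apply/val_inj; apply: h1 => //; exact: Aval.
- exists fst; split.
  + by apply: continuous_subspaceT => p; exact: cvg_fst.
  + move=> i; apply/enum_val_inj/(@vertex_inj R).
    exact: (etrans (esym (inD i).2) (esym (valF (G i)))).
  + by [].
Qed.

End HomotopyType.

(** * Geometric realizations of acyclic hypergraphs *)

Section Realization.
Variables (R : realType) (T : finType).
Implicit Types (K : {set {set T}}) (t : {set T}) (v w : T).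

Local Notation points := (@realization_set R T).

(** The support is a face of [t], and it is non-empty because the coordinates sum to 1. *)
Lemma realization_setS K t (x : T -> R) :
  (forall s t : {set T},
     t \in K -> s \subset t -> s != finset.set0 -> s \in K) ->
  t \in K -> (forall u, 0 <= x u) -> \sum_u x u = 1 ->
  (forall u, x u != 0 -> u \in t) -> points K x.
Proof.
move=> KS tK x0 x1 xt; split=> //.
apply: KS tK _ _; first by apply/fintype.subsetP => u; rewrite inE; exact: xt.
apply/eqP => s0; suff : \sum_u x u = 0 by rewrite x1 => /eqP; rewrite oner_eq0.
apply: big1 => u _; apply/eqP; apply/negP => /negP xu.
by have := finset.in_set0 u; rewrite -s0 inE xu.
Qed.

Lemma realization_set_support K (x : T -> R) : points K x ->
  exists2 t, t \in K & forall u, (u \in t) = (x u != 0).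
Proof. by move=> [_ _ /support_inP]. Qed.

Lemma sum_vertex v : \sum_u vertex R v u = 1.
Proof.
by rewrite (bigD1 v) //= big1 ?addr0 /vertex ?eqxx // => u /negPf->.
Qed.

Lemma realization_set_vertex K v :
  [set v]%SET \in K -> points K (vertex R v).
Proof.
move=> vK; split; [by move=> u; rewrite /vertex ler0n|exact: sum_vertex|].
apply/support_inP; exists [set v]%SET => // u.
by rewrite inE /vertex pnatr_eq0 eqb0 negbK.
Qed.

Lemma realization_set_delete_vertex K v (x : T -> R) :
  points [set t in K | v \notin t]%SET x <->
  points K x /\ x v = 0.
Proof.
split=> [[x0 x1 /support_inP[t]]|[[x0 x1 /support_inP[t tK xt]] xv]].
  rewrite inE => /andP[tK vt] xt; split.
    by split=> //; apply/support_inP; exists t.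
  by apply/eqP; rewrite -[_ == _]negbK -xt.
split=> //; apply/support_inP; exists t => //.
by rewrite inE tK xt xv eqxx.
Qed.

(** A point with non-zero weight at [v] has support [[set v]], so its total weight 1 sits at [v]. *)
Lemma realization_set_isolated K v : [set v]%SET \in K ->
  (forall t, t \in K -> v \in t -> t = [set v]%SET) ->
  points K =
  vertex R v |` points [set t in K | v \notin t]%SET.
Proof.
move=> vK Kv; apply/seteqP; split=> x; last first.
  by move=> [->|/realization_set_delete_vertex[]//]; exact: realization_set_vertex.
move=> Kx; have [xv|xv] := eqVneq (x v) 0.
  by right; apply/realization_set_delete_vertex.
have [t tK xt] := realization_set_support Kx; left.
have tv : t = [set v]%SET by apply: Kv => //; rewrite xt.
have x0 u : u != v -> x u = 0.
  by move=> uv; apply/eqP; rewrite -[_ == _]negbK -xt tv inE.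
apply/funext => u; rewrite /vertex; have [->|uv] := eqVneq u v; last exact: x0.
by have [_ <- _] := Kx; rewrite (bigD1 v) //= big1 ?addr0.
Qed.

(** If the support [t] of [x] contains [v], the segment from [x] to its slide stays in the simplex
    [w |: t]. *)
Lemma deforms_to_vertices_dominated K v w :
  (forall s t : {set T},
     t \in K -> s \subset t -> s != finset.set0 -> s \in K) ->
  w != v -> (forall t, t \in K -> v \in t -> (w |: t)%SET \in K) ->
  deforms_to_vertices (points [set t in K | v \notin t]%SET) ->
  deforms_to_vertices (points K).
Proof.
move=> KS wv Kw.
have vw : (v == w) = false by rewrite eq_sym (negPf wv).
have line (x : T -> R) (c : R) : points K x -> 0 <= c <= 1 ->
    points K (fun u => slide v w x u + c * (x u - slide v w x u)).
  move=> Kx /andP[c0 c1]; have [x0 x1 _] := Kx.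
  have [xv|xv] := eqVneq (x v) 0.
    rewrite slide_id //; congr (points K _): Kx.
    by apply/funext => u; rewrite subrr mulr0 addr0.
  have [t tK xt] := realization_set_support Kx.
  apply: (@realization_setS _ (w |: t)%SET) => //.
  - by apply: Kw => //; rewrite xt.
  (* The coordinates are [c * x v] at [v], [x w + (1 - c) * x v] at [w], and [x u] elsewhere. *)
  - move=> u; have xu := x0 u; have cx := mulr_ge0 c0 (x0 v).
    have c1x : 0 <= (1 - c) * x v by rewrite mulr_ge0 ?subr_ge0.
    rewrite /slide /vertex; have [->|uv] := eqVneq u v.
      by rewrite vw mulr0n mulr1n; lra.
    by have [_|_] := eqVneq u w; rewrite !(mulr0n, mulr1n); lra.
  - rewrite big_split /= -mulr_sumr sumrB.
    have -> : \sum_u slide v w x u = 1.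
      rewrite /slide big_split /= -mulr_sumr sumrB !sum_vertex x1; ring.
    by rewrite x1 subrr mulr0 addr0.
  - move=> u; rewrite !inE xt; have [//|uw /=] := eqVneq u w.
    apply: contraNneq => xu; rewrite /slide /vertex (negPf uw) xu.
    by have [uv|_] := eqVneq u v; [rewrite -uv xu|]; apply/eqP; ring.
apply: (@deforms_to_vertices_slide _ _ _ _ v w) => //.
- by move=> x /realization_set_delete_vertex[].
- by move=> x /realization_set_delete_vertex[].
- move=> x Kx; apply/realization_set_delete_vertex; split.
    (* The slide is the end [c = 0] of the segment. *)
    have := line x 0 Kx; rewrite lexx ler01 => /(_ isT).
    by under eq_fun do rewrite mul0r addr0.
  by rewrite /slide /vertex eqxx vw mulr0n mulr1n; ring.
Qed.

Lemma deforms_to_vertices_acyclic (H : {set {set T}}) :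
  hypergraph H -> acyclic H ->
  deforms_to_vertices (points (associated_complex H)).
Proof.
move: H; apply: acyclic_ind.
  suff -> : points (associated_complex finset.set0) = set0.
    exact: deforms_to_vertices0.
  apply/seteqP; split=> // x /realization_set_support[t].
  by move=> /associated_complexP[_ [e]]; rewrite inE.
move=> H _ hH [v s vs|s s' sH s'H ss']; last first.
  by rewrite (associated_complex_delete_edge sH s'H ss').
rewrite (associated_complex_delete_vertex vs).
have [sH vins] := unique_edge vs; have sK := mem_associated_complex hH sH.
have Kv := associated_complex_unique_edge vs.
have [s1|] := finset.set_0Vmem (s :\ v)%SET.
  have sv : s = [set v]%SET by rewrite -(finset.setD1K vins) s1 finset.setU0.
  rewrite [in X in _ -> X](@realization_set_isolated _ v) -?sv //.
    by apply: deforms_to_vertices_isolated => x /realization_set_delete_vertex[].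
  move=> t tK vt; apply/eqP; rewrite finset.eqEsubset Kv //=.
  by rewrite sv finset.sub1set.
move=> [w /finset.setD1P[wv ws]].
apply: (@deforms_to_vertices_dominated _ _ w) => //.
  by move=> t' t; exact: associated_complexS.
(* Simplices through [v] lie in [s], which also contains [w]. *)
move=> t tK vt; apply: (associated_complexS sK).
  by rewrite finset.subUset finset.sub1set ws Kv.
by apply/finset.set0Pn; exists w; rewrite !inE eqxx.
Qed.

End Realization.

Theorem theorem5p2 (R : realType) (T : finType) (H : {set {set T}})
    (hH : hypergraph H) :
  (acyclic H ->
     acyclic (associated_complex H) /\
     exists n : nat,
       homotopy_equivalent R
         (realization R (associated_complex H))
         (discrete_topology 'I_n)) /\
  ((exists S : {set {set T}},
      disjoint_simplices S /\ associated_complex H = associated_complex S) ->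
   acyclic H).
Proof.
split=> [aH|[S [dS KHS]]].
  split; first by apply: rt_trans aH; exact: associated_complex_reduces.
  by apply: deforms_to_vertices_homotopy; exact: deforms_to_vertices_acyclic.
exact: acyclic_of_disjoint_simplices_complex KHS.
Qed.
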